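(* For all integers $n\ge 2$ there exists an $n$-good set $A$ with $\#A=\mathcal{O}(\sqrt{n})$. That is, there is an absolute constant $K>0$ such that for every integer $n\ge 2$ there exists an $n$-good set $A$ with $\#A\le K\sqrt{n}$.
   Context: For an integer $n\ge 2$ and a set $A$ of integers with $0,n-1\in A\subset\{0,1,\dots,n-1\}$, $C_A=C_{A,n}=\left\{\sum_{i=1}^\infty a_i n^{-i} : a_i\in A\right\}$, which is the attractor of the iterated function system $\{x\mapsto (x+a)/n : a\in A\}$. The sign $+$ between sets denotes the Minkowski sum. The set $A$ is called $n$-good if $0,n-1\in A\subset\{0,1,\dots,n-1\}$ and $C_A+C_A=[0,2]$. $\#A$ denotes the cardinality of $A$. *)

(* Defs.v *)
From HB Require Import structures.
From mathcomp Require Import all_boot all_order all_algebra finmap.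
From mathcomp Require Import all_classical all_reals all_analysis.

Set Implicit Arguments.
Unset Strict Implicit.
Unset Printing Implicit Defensive.

Import Order.TTheory GRing.Theory Num.Theory.
Import numFieldNormedType.Exports.

Local Open Scope classical_set_scope.
Local Open Scope ring_scope.

(* [digits i] is the digit a_{i+1} of the expansion \sum_{i >= 1} a_i n^{-i}. *)
Definition cantor_like (R : realType) (n : nat) (A : {fset int}) : set R :=
  [set x : R | exists2 digits : nat -> int,
     (forall i, digits i \in A) &
     series (fun i : nat => (digits i)%:~R * (n%:R : R) ^- i.+1) @ \oo --> x].
Arguments cantor_like R n A : clear implicits.

Definition minkowski_sum (V : zmodType) (X Y : set V) : set V :=
  [set x + y | x in X & y in Y].

Definition n_good (R : realType) (n : nat) (A : {fset int}) : Prop :=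
  [/\ 0 \in A,
      n%:Z - 1 \in A,
      (forall a : int, a \in A -> 0 <= a <= n%:Z - 1) &
      minkowski_sum (cantor_like R n A) (cantor_like R n A) = `[0, 2]%classic].
Arguments n_good R n A : clear implicits.

(* Main.v *)
Require Import Defs.
From mathcomp Require Import all_boot all_order all_algebra finmap.
From mathcomp Require Import all_classical all_reals all_analysis.
From mathcomp Require Import ring lra zify.

Set Implicit Arguments.
Unset Strict Implicit.
Unset Printing Implicit Defensive.

Import Order.TTheory GRing.Theory Num.Theory.
Import numFieldNormedType.Exports.

Local Open Scope classical_set_scope.
Local Open Scope ring_scope.

(** If [A] is contained in [{0, ..., n-1}] and the sums of two elements of [A]
    exhaust [{0, ..., 2n-2}], then [C_A + C_A = [0, 2]]: every point of [[0, 2]]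
    has an expansion in base [n] with digits in [{0, ..., 2n-2}], found by a
    greedy algorithm ([cvg_greedy_series]); splitting each digit as [a + b] with
    [a], [b] in [A] splits the point into two points of [C_A]
    ([n_good_of_sumset]).

    So an additive 2-basis of [{0, ..., 2n-2}] of size [O(sqrt n)] inside
    [{0, ..., n-1}] suffices.  Let [m] be an integer with [m ^ 2 >= n].  Division
    by [m] writes each [s < n] as [m q + r] with [q, r < m], hence as a sum of
    two elements of [B = {0, ..., m-1} U m {0, ..., m-1}], both at most [s].
    Adding to [B] its mirror image [n - 1 - B] also reaches the upper half
    [n, ..., 2n-2], by the symmetry [s |-> 2n-2-s] of the sumset.  The result
    has at most [4m] elements, and [m] can be taken to be at most
    [1 + sqrt n <= 2 sqrt n]. *)

(** * Base-n series with digits between 0 and n-1 *)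

Definition digit_series (R : realType) (n : nat) (d : nat -> int) : R^nat :=
  series (fun i => (d i)%:~R * (n%:R : R) ^- i.+1).
Arguments digit_series R n d : clear implicits.

Lemma cvg_exprVn (R : realType) (n : nat) : (2 <= n)%N ->
  (n%:R : R) ^- k @[k --> \oo] --> (0 : R).
Proof.
move=> n2; under eq_fun do rewrite -exprVn.
apply: cvg_expr; rewrite ger0_norm ?invr_ge0 ?ler0n//.
by rewrite invf_lt1 ?ltr0n ?ltr1n //; lia.
Qed.

(** The upper bound is the value of the partial sum with all digits [n - 1]. *)
Lemma digit_series_itv (R : realType) (n : nat) (d : nat -> int) k :
    (2 <= n)%N -> (forall i, 0 <= d i <= n%:Z - 1) ->
  0 <= digit_series R n d k <= 1 - (n%:R : R) ^- k.
Proof.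
move=> n2 dn; have n0 : (n%:R : R) != 0 by rewrite pnatr_eq0; lia.
elim: k => [|k /andP[ge0 le1]].
  by rewrite /digit_series /series /= big_geq// expr0 invr1 subrr lexx.
rewrite /digit_series seriesSr -/(digit_series R n d k).
have /andP[d0 d1] := dn k.
have p0 : 0 < (n%:R : R) ^- k.+1 by rewrite invr_gt0 exprn_gt0// ltr0n; lia.
have D0 : 0 <= ((d k)%:~R : R) by rewrite ler0z.
have D1 : ((d k)%:~R : R) <= n%:R - 1.
  by rewrite -(ler_int R) intrB in d1.
have -> : 1 - (n%:R : R) ^- k.+1 =
    1 - n%:R ^- k + (n%:R - 1) * (n%:R : R) ^- k.+1.
  by rewrite exprS; field; rewrite expf_neq0// n0.
rewrite addr_ge0 ?mulr_ge0 ?(ltW p0)//=.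
by rewrite lerD// ler_pM2r.
Qed.

Lemma cvgn_digit_series (R : realType) (n : nat) (d : nat -> int) :
    (2 <= n)%N -> (forall i, 0 <= d i <= n%:Z - 1) ->
  cvgn (digit_series R n d).
Proof.
move=> n2 dn; apply: nondecreasing_is_cvgn.
  apply: nondecreasing_series => i _ _.
  have /andP[d0 _] := dn i.
  by rewrite mulr_ge0 ?ler0z ?invr_ge0 ?exprn_ge0.
exists 1 => _ [k _ <-].
have /andP[_ le1] := digit_series_itv R k n2 dn.
by rewrite (le_trans le1)// gerBl invr_ge0 exprn_ge0.
Qed.

Lemma cantor_like_itv (R : realType) (n : nat) (A : {fset int}) (x : R) :
    (2 <= n)%N -> (forall a, a \in A -> 0 <= a <= n%:Z - 1) ->
  Defs.cantor_like R n A x -> 0 <= x <= 1.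
Proof.
move=> n2 An [d dA cx].
have dn i : 0 <= d i <= n%:Z - 1 by apply: An.
have cd : cvgn (digit_series R n d) by apply: cvgn_digit_series.
have <- := cvg_lim (@norm_hausdorff _ R) cx; apply/andP; split.
  by apply: limr_ge => //; apply: nearW => k;
    case/andP: (digit_series_itv R k n2 dn).
apply: limr_le => //; apply: nearW => k.
have /andP[_ /le_trans->//] := digit_series_itv R k n2 dn.
Qed.

(** * Greedy expansions of the points of [0, 2] *)

(** The digit is capped at [2(n-1)], the largest sum of two digits; only points
    [x] close to [2] are affected, since [n x] may be as large as [2n]. *)
Definition greedy_digit (R : realType) (n : nat) (x : R) : nat := minn (Num.truncn (n%:R * x)) (n.-1.*2).

(** The remainder after [k] digits, rescaled by [n ^ k] so that it stays in
    [[0, 2]] instead of shrinking. *)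
Definition greedy_rest (R : realType) (n : nat) (x : R) (k : nat) : R :=
  iter k (fun y => n%:R * y - (greedy_digit n y)%:R) x.

Definition greedy_digits (R : realType) (n : nat) (x : R) (k : nat) : int :=
  greedy_digit n (greedy_rest n x k).

(** The interval [[0, 2]] is preserved because [n y] lies in [[0, 2n]]: an
    uncapped digit leaves the fractional part of [n y], and a capped one leaves
    at most [2n - (2n-2) = 2]. *)
Lemma greedy_rest_itv (R : realType) (n : nat) (x : R) k :
  (2 <= n)%N -> 0 <= x <= 2 -> 0 <= greedy_rest n x k <= 2.
Proof.
move=> n2 x02; elim: k => //= k; set y := greedy_rest n x k => /andP[y0 y2].
have ny0 : 0 <= n%:R * y by rewrite mulr_ge0.
have /andP[tl tu] := truncn_itv ny0.
rewrite /greedy_digit; case: leqP => [tn|/ltnW nt].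
  rewrite -natr1 in tu; lra.
have nD : ((n.-1.*2)%:R : R) = 2 * n%:R - 2.
  have -> : (n%:R : R) = n.-1%:R + 1 by rewrite natr1 prednK//; lia.
  by rewrite -muln2 natrM; ring.
have nt' : ((n.-1.*2)%:R : R) <= n%:R * y by rewrite (le_trans _ tl)// ler_nat.
have : n%:R * y <= n%:R * 2 by rewrite ler_wpM2l.
lra.
Qed.

Lemma greedy_seriesE (R : realType) (n : nat) (x : R) k : (2 <= n)%N ->
  digit_series R n (greedy_digits n x) k =
  x - greedy_rest n x k * (n%:R : R) ^- k.
Proof.
move=> n2.
have n0 : (n%:R : R) != 0 by rewrite pnatr_eq0; lia.
elim: k => [|k IH].
  by rewrite /digit_series /series /= big_geq// expr0 invr1 mulr1 subrr.
rewrite /digit_series seriesSr -/(digit_series R n _ k) IH /= /greedy_digits.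
by rewrite -pmulrn exprS; field; rewrite expf_neq0// n0.
Qed.

Lemma cvg_greedy_series (R : realType) (n : nat) (x : R) :
    (2 <= n)%N -> 0 <= x <= 2 ->
  digit_series R n (greedy_digits n x) @ \oo --> x.
Proof.
move=> n2 x02.
rewrite (_ : digit_series _ _ _ =
    (fun k => x - greedy_rest n x k * (n%:R : R) ^- k)); last first.
  by apply/funext => k; exact: greedy_seriesE.
rewrite -[X in _ --> X]subr0; apply: cvgB; first exact: cvg_cst.
have c2 : 2 * (n%:R : R) ^- k @[k --> \oo] --> (0 : R).
  by rewrite -(mulr0 2); apply: cvgMr; exact: cvg_exprVn.
apply: squeeze_cvgr (cvg_cst 0) c2; apply: nearW => k.
have /andP[r0 r2] := greedy_rest_itv k n2 x02.
have p0 : 0 <= (n%:R : R) ^- k by rewrite invr_ge0 exprn_ge0.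
by rewrite mulr_ge0//= ler_wpM2r.
Qed.

(** * From additive bases to good digit sets *)

(** A greedy expansion with digits up to [2(n-1)] is split digit by digit; both
    halves converge because their digits lie in [A], and their limits add up to
    the expanded point. *)
Lemma n_good_of_sumset (R : realType) (n : nat) (A : {fset int}) :
    (2 <= n)%N -> 0 \in A -> n%:Z - 1 \in A ->
    (forall a, a \in A -> 0 <= a <= n%:Z - 1) ->
    (forall s : nat, (s <= n.-1.*2)%N ->
       exists2 ab : int * int, ab.1 \in A /\ ab.2 \in A & s%:Z = ab.1 + ab.2) ->
  n_good R n A.
Proof.
move=> n2 A0 An Abnd Asum; split=> //; apply/seteqP; split=> x /=.
  move=> [y /(cantor_like_itv n2 Abnd) /andP[y0 y1]].
  move=> [z /(cantor_like_itv n2 Abnd) /andP[z0 z1] <-].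
  by rewrite in_itv/=; apply/andP; split; lra.
rewrite in_itv/= => x02.
have [ab abA abE] : exists2 ab : nat -> int * int,
    (forall k, (ab k).1 \in A /\ (ab k).2 \in A) &
    (forall k, greedy_digits n x k = (ab k).1 + (ab k).2).
  have /choice[ab abP] : forall k, exists p : int * int,
      (p.1 \in A /\ p.2 \in A) /\ greedy_digits n x k = p.1 + p.2.
    move=> k; have [|p pA pE] := Asum (greedy_digit n (greedy_rest n x k)).
      exact: geq_minr.
    by exists p.
  by exists ab => k; case: (abP k).
have sE : digit_series R n (greedy_digits n x) =
    digit_series R n (fst \o ab) \+ digit_series R n (snd \o ab).
  apply/funext => k; rewrite /digit_series /series /= -big_split/=.
  by apply: eq_bigr => i _; rewrite abE intrD mulrDl.
have ca : cvgn (digit_series R n (fst \o ab)).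
  by apply: cvgn_digit_series => // i; apply: Abnd; case: (abA i).
have cb : cvgn (digit_series R n (snd \o ab)).
  by apply: cvgn_digit_series => // i; apply: Abnd; case: (abA i).
exists (limn (digit_series R n (fst \o ab))).
  by exists (fst \o ab) => // i; case: (abA i).
exists (limn (digit_series R n (snd \o ab))).
  by exists (snd \o ab) => // i; case: (abA i).
apply: (cvg_unique (@norm_hausdorff _ R) (cvgD ca cb)).
by have := cvg_greedy_series n2 x02; rewrite sE.
Qed.

(** * An additive basis of size O(sqrt n) *)

Definition grid (m : nat) : seq nat := iota 0 m ++ [seq (m * q)%N | q <- iota 0 m].

(** The mirror image [n - 1 - B] of the truncated grid [B] makes the set invariant
    under [a |-> n - 1 - a], hence its sumset under [s |-> 2n - 2 - s]. *)
Definition sqrt_digits (n m : nat) : {fset int} :=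
  let B := [seq b <- grid m | (b < n)%N] in
  [fset a in [seq b%:Z | b <- B] ++ [seq n%:Z - 1 - b%:Z | b <- B]]%fset.

Lemma grid_sum (m s : nat) : (s < m ^ 2)%N ->
  exists2 bc : nat * nat, bc.1 \in grid m /\ bc.2 \in grid m & s = (bc.1 + bc.2)%N.
Proof.
move=> sm; have m0 : (0 < m)%N by case: m sm.
exists (m * (s %/ m), s %% m)%N; last by rewrite mulnC -divn_eq.
rewrite /= !mem_cat; split; apply/orP; [right|left].
  by apply/map_f; rewrite mem_iota add0n ltn_divLR //.
by rewrite mem_iota add0n ltn_mod.
Qed.

Lemma mem_sqrt_digits (n m b : nat) : b \in grid m -> (b < n)%N ->
  b%:Z \in sqrt_digits n m /\ n%:Z - 1 - b%:Z \in sqrt_digits n m.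
Proof.
move=> bm bn; rewrite !in_fset !mem_cat.
have bB : b \in [seq b <- grid m | (b < n)%N] by rewrite mem_filter bn.
by split; apply/orP; [left|right]; apply: map_f bB.
Qed.

Lemma sqrt_digits_bound (n m : nat) (a : int) :
  a \in sqrt_digits n m -> 0 <= a <= n%:Z - 1.
Proof.
by rewrite in_fset mem_cat => /orP[] /mapP[b]; rewrite mem_filter => /andP[bn _] ->; lia.
Qed.

Lemma card_sqrt_digits (n m : nat) : (#|` sqrt_digits n m| <= 4 * m)%N.
Proof.
rewrite /sqrt_digits card_fseq (leq_trans (size_undup _))//.
rewrite size_cat !size_map size_filter.
have := count_size (fun b => b < n)%N (grid m).
rewrite {2}/grid size_cat size_map size_iota; lia.
Qed.

Lemma n_good_sqrt_digits (R : realType) (n m : nat) :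
  (2 <= n)%N -> (n <= m ^ 2)%N -> n_good R n (sqrt_digits n m).
Proof.
move=> n2 nm; have m0 : (0 < m)%N by case: m nm => //; lia.
have [] : 0%N%:Z \in sqrt_digits n m /\ n%:Z - 1 - 0%N%:Z \in sqrt_digits n m.
  by apply: mem_sqrt_digits; [rewrite mem_cat mem_iota m0|lia].
rewrite subr0 => A0 An.
apply: n_good_of_sumset => //; first exact: sqrt_digits_bound.
(* Sums below [n] come from the grid, the others from its mirror image. *)
move=> s sn; have [sltn|nles] := ltnP s n.
  have [[b c] /= [bm cm] sE] := grid_sum (leq_trans sltn nm).
  exists (b%:Z, c%:Z) => /=; last by lia.
  by split; apply: (mem_sqrt_digits _ _).1 => //; lia.
have [|[b c] /= [bm cm] sE] := @grid_sum m (n.-1.*2 - s)%N; first by lia.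
exists (n%:Z - 1 - b%:Z, n%:Z - 1 - c%:Z) => /=; last by lia.
by split; apply: (mem_sqrt_digits _ _).2 => //; lia.
Qed.

Theorem theorem2p2 (R : realType) :
  exists K : R, 0 < K /\
    forall n : nat, (2 <= n)%N ->
      exists A : {fset int},
        n_good R n A /\ (#|` A|%:R : R) <= K * Num.sqrt (n%:R : R).
Proof.
(* At most [4 m] digits with [m <= 1 + sqrt n <= 2 sqrt n]. *)
exists 8; split=> // n n2.
have r0 : 0 <= Num.sqrt (n%:R : R) := sqrtr_ge0 _.
have rr : Num.sqrt (n%:R : R) ^+ 2 = n%:R by rewrite sqr_sqrtr.
have r1 : 1 <= Num.sqrt (n%:R : R).
  by rewrite -[leLHS]sqrtr1 ler_wsqrtr// ler1n; lia.
have /andP[tl tu] := truncn_itv r0.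
set t := Num.truncn _ in tl tu.
exists (sqrt_digits n t.+1); split.
  apply: n_good_sqrt_digits => //.
  by rewrite -(ler_nat R) natrX -rr lerXn2r ?nnegrE// ltW.
apply: (@le_trans _ _ (4 * t.+1)%:R); first by rewrite ler_nat card_sqrt_digits.
rewrite natrM -natr1; lra.
Qed.
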